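(* Let $G=(V\cup\{m\},E)$ and $G'=(V'\cup\{m'\},E')$ be comparability graphs with disjoint vertex sets such that $m$ is a source of some transitive orientation of $G$ and $m'$ is a sink of some transitive orientation of $G'$. Then the split recomposition $G\ast G'$ is a comparability graph.
   Context: All graphs are finite, simple and connected. An orientation is transitive if $\overrightarrow{ab},\overrightarrow{bc}$ imply $\overrightarrow{ac}$; a comparability graph is one admitting a transitive orientation. A source (sink) is a vertex of in-degree (out-degree) zero. Split recomposition: for graphs $G=(V\cup\{m\},E)$ and $G'=(V'\cup\{m'\},E')$ with disjoint vertex sets, $G\ast G'$ has vertex set $V\cup V'$ and edges: those of $G[V]$, those of $G'[V']$, and all $\overline{ab}$ with $a\in N_G(m)$, $b\in N_{G'}(m')$. *)

(* Defs.v *)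
From mathcomp Require Import all_boot.

Set Implicit Arguments.
Unset Strict Implicit.
Unset Printing Implicit Defensive.

(* Connectedness is kept as a separate predicate: deleting a vertex from a
   connected graph may disconnect it. *)
Record sgraph := SGraph {
  vertex :> finType;
  edge : rel vertex;
  edge_sym : symmetric edge;
  edge_irrefl : irreflexive edge }.

Definition connected (G : sgraph) : Prop :=
  forall x y : G, connect (@edge G) x y.

(* [o x y] means that the edge xy is directed from x to y. *)
Definition orientation (G : sgraph) (o : rel G) : Prop :=
  (forall x y : G, edge x y = o x y || o y x) /\
  (forall x y : G, ~~ (o x y && o y x)).

Definition transitive_orientation (G : sgraph) (o : rel G) : Prop :=
  orientation o /\ transitive o.

Definition comparability_graph (G : sgraph) : Prop :=
  exists o : rel G, transitive_orientation o.

Definition indegree (G : sgraph) (o : rel G) (x : G) : nat :=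
  #|[set y | o y x]|.

Definition outdegree (G : sgraph) (o : rel G) (x : G) : nat :=
  #|[set y | o x y]|.

Definition source (G : sgraph) (o : rel G) (x : G) : Prop := indegree o x = 0.

Definition sink (G : sgraph) (o : rel G) (x : G) : Prop := outdegree o x = 0.

Section SplitRecomposition.

Variables (G G' : sgraph) (m : G) (m' : G').

(* V and V' are the vertex sets of G and G' without the markers m and m';
   the sum type makes them disjoint. *)
Definition recomp_vertex : finType := ({x : G | x != m} + {x : G' | x != m'})%type.

Definition recomp_edge : rel recomp_vertex := fun u v =>
  match u, v with
  | inl a, inl b => edge (val a) (val b)
  | inr a, inr b => edge (val a) (val b)
  | inl a, inr b | inr b, inl a => edge m (val a) && edge m' (val b)
  end.

Fact recomp_edge_sym : symmetric recomp_edge.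
Proof. by move=> [a|a] [b|b] //=; apply: edge_sym. Qed.

Fact recomp_edge_irrefl : irreflexive recomp_edge.
Proof. by move=> [a|a] /=; apply: edge_irrefl. Qed.

Definition split_recomposition : sgraph :=
  SGraph recomp_edge_sym recomp_edge_irrefl.

End SplitRecomposition.

(* Main.v *)
(** Orient every cross edge from V' to V.  If m -> a -> c in G then m -> c, as m
is a source, so N(m) is closed under successors; dually N(m') is closed under
predecessors because m' is a sink.  These closures give transitivity along a
path with exactly one cross arc, and no path has two. *)

Require Import Defs.
From mathcomp Require Import all_boot.

(** No arc enters [m], so every edge at [m] leaves it. This turns the adjacency to [m] in cross arcs
    into arcs of [o], which transitivity can compose. *)
Lemma edge_source (G : sgraph) (o : rel G) (m x : G) :
  orientation o -> source o m -> edge m x = o m x.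
Proof.
move=> [oE _] /eqP; rewrite cards_eq0 => /eqP/setP/(_ x).
by rewrite !inE oE => ->; rewrite orbF.
Qed.

Lemma edge_sink (G : sgraph) (o : rel G) (m x : G) :
  orientation o -> sink o m -> edge m x = o x m.
Proof.
by move=> [oE _] /eqP; rewrite cards_eq0 => /eqP/setP/(_ x); rewrite !inE oE => ->.
Qed.

Definition recomp_orientation (G G' : sgraph) (m : G) (m' : G')
    (o : rel G) (o' : rel G') : rel (split_recomposition m m') :=
  fun u v => match u, v with
  | inl a, inl b => o (val a) (val b)
  | inr a, inr b => o' (val a) (val b)
  | inr b, inl a => edge m (val a) && edge m' (val b)
  | inl _, inr _ => false
  end.

Theorem theorem4 (G G' : sgraph) (m : G) (m' : G')
    (connG : connected G) (connG' : connected G')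
    (compG : comparability_graph G) (compG' : comparability_graph G')
    (m_source : exists o : rel G, transitive_orientation o /\ source o m)
    (m'_sink : exists o' : rel G', transitive_orientation o' /\ sink o' m') :
  comparability_graph (split_recomposition m m').
Proof.
have [o [[oG o_trans] src]] := m_source.
have [o' [[oG' o'_trans] snk]] := m'_sink.
have [[oE oA] [o'E o'A]] := (oG, oG').
exists (recomp_orientation G G' m m' o o'); split; first split.
- by move=> [a|a] [b|b] //=; rewrite ?orbF.
- by move=> [a|a] [b|b] //=; rewrite ?andbF.
(* The path is [a], [b], [c]: [transitive] quantifies its middle vertex first. *)
move=> [b|b] [a|a] [c|c] //=; try by [apply: o_trans | apply: o'_trans].
(* Only [a] lies in V': m -> b -> c gives m -> c. *)
- rewrite !(edge_source G o) // => /andP[m_b ->] /(o_trans _ _ _ m_b) ->.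
  by [].
(* Only [c] lies in V: a -> b -> m' gives a -> m'. *)
- rewrite !(edge_sink G' o') // => a_b /andP[-> /(o'_trans _ _ _ a_b) ->].
  by [].
Qed.
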